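(* Let $(M,\theta)$ be a tension space, let $\tau,\sigma:M\to M$ be two commuting bijections such that $\theta(\tau(p),\sigma(p))>0$ for every $p\in M$, and let $(M_k)_{k\in\mathbb Z}$ be a $(\tau,\sigma)$-partition of $M$ with associated index function $\lfloor\cdot\rfloor:M\to\mathbb Z$. Let $\mathcal A\subset\mathbb R^M$ be an $\mathbb R$-algebra of functions with $\sigma^*\mathcal A\subset\mathcal A$ and $\tau^*\mathcal A\subset\mathcal A$, and let $D_{\tau,\sigma}:\mathcal A\to\mathcal A$ be the $(\tau,\sigma)$-quantum derivative. Then a right inverse $R_{\tau,\sigma}$ of $D_{\tau,\sigma}$ is given by $$R_{\tau,\sigma}f(p)=\begin{cases}-\sum\limits_{m=0}^{-\lfloor p\rfloor-1}\theta\big(\tau^{m+1}\sigma^{-m-1}(p),\tau^m\sigma^{-m}(p)\big)\,f(\tau^m\sigma^{-m-1}(p)) & \text{if }\lfloor p\rfloor\le -1,\\[2mm] 0 & \text{if }\lfloor p\rfloor=0,\\[1mm] \sum\limits_{m=1}^{\lfloor p\rfloor}\theta\big(\tau^{-m+1}\sigma^{m-1}(p),\tau^{-m}\sigma^{m}(p)\big)\,f(\tau^{-m}\sigma^{m-1}(p)) & \text{if }\lfloor p\rfloor\ge 1,\end{cases}$$ for $f\in\mathcal A$ and $p\in M$.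
   Context: A tension function on a nonempty set $M$ is a function $\theta:M\times M\to\mathbb R$ with $\theta(p_1,p_2)+\theta(p_2,p_3)=\theta(p_1,p_3)$ for all $p_1,p_2,p_3\in M$; the pair $(M,\theta)$ is called a tension space. Tension spaces are assumed nontrivial, i.e. $\theta(p,q)\ne 0$ for some $p,q\in M$. For a map $\alpha:M\to M$ and $f\in\mathbb R^M$, $\alpha^*f=f\circ\alpha$. Juxtaposition of maps on $M$ denotes composition, and integer powers denote iterates (negative powers: iterates of the inverse). The $(\tau,\sigma)$-quantum derivative is the mapping $D_{\tau,\sigma}:\mathcal A\to\mathcal A$ given by $$D_{\tau,\sigma}f(p)=\frac{f(\tau(p))-f(\sigma(p))}{\theta(\tau(p),\sigma(p))}.$$ A $(\tau,\sigma)$-partition of $M$ is a family of subsets $M_k\subset M$, $k\in\mathbb Z$, such that (1) $\bigcup_{k\in\mathbb Z}M_k=M$; (2) $M_{k_1}\cap M_{k_2}=\emptyset$ for any $k_1\ne k_2$; (3) $\tau\sigma^{-1}:M_k\to M_{k+1}$ is a bijective mapping for every $k\in\mathbb Z$. Its index function is defined by $\lfloor p\rfloor=k$ iff $p\in M_k$. A linear operator $R$ defined on all of a real linear space $X$, with values in $X$, is a right inverse of a linear operator $D$ in $X$ if $DR=I$, where $I$ is the identity of $X$. Here $X=\mathcal A$.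
   Formalization: That R maps A into A is assumed for the claim that R is a right inverse in A, since it can fail (M = Z, A = the constants, tau(p) = p+1, sigma = id, where D = 0 on A); linearity of R and D(Rf) = f for all f in A are proved without it. *)

(* Defs.v *)
From HB Require Import structures.
From mathcomp Require Import all_boot all_order all_algebra.
From mathcomp Require Import all_classical all_reals.

Set Implicit Arguments.
Unset Strict Implicit.
Unset Printing Implicit Defensive.

Import Order.TTheory GRing.Theory Num.Theory.

Local Open Scope classical_set_scope.
Local Open Scope ring_scope.

Definition tension_function (R : realType) (M : Type) (theta : M -> M -> R) :=
  forall p1 p2 p3 : M, theta p1 p2 + theta p2 p3 = theta p1 p3.

(* Nontriviality entails that M is nonempty. *)
Definition tension_space (R : realType) (M : Type) (theta : M -> M -> R) :=
  tension_function theta /\ exists p q : M, theta p q != 0.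

(* A bijection M -> M is a {splitbij [set: M] >-> [set: M]}: the structure
   carries the inverse f^-1, which is two-sided (funK, invK) and so unique. *)
Definition iterz (M : Type) (f : {splitbij [set: M] >-> [set: M]}) (n : int)
    : M -> M :=
  match n with
  | Posz k => iter k f
  | Negz k => iter k.+1 f^-1%FUN
  end.

Definition quantum_derivative (R : realType) (M : Type) (theta : M -> M -> R)
    (tau sigma : M -> M) (f : M -> R^o) : M -> R^o :=
  fun p => (f (tau p) - f (sigma p)) / theta (tau p) (sigma p).

Definition quantum_partition (M : Type)
    (tau sigma : {splitbij [set: M] >-> [set: M]}) (Mk : int -> set M) :=
  [/\ \bigcup_k Mk k = [set: M],
      trivIset [set: int] Mk
    & forall k : int, set_bij (Mk k) (Mk (k + 1)) (tau \o sigma^-1%FUN)].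

Definition index_function (M : Type) (Mk : int -> set M) (idx : M -> int) :=
  forall (p : M) (k : int), idx p = k <-> Mk k p.

(* The three cases of the formula; the bounds 0 <= m <= - idx p - 1 and
   1 <= m <= idx p are written with half-open ranges of naturals. *)
Definition quantum_sum (R : realType) (M : Type)
    (theta : M -> M -> R) (tau sigma : {splitbij [set: M] >-> [set: M]})
    (idx : M -> int) (f : M -> R^o) : M -> R^o :=
  fun p =>
    if idx p <= -1 then
      - \sum_(0 <= m < `|idx p|%N)
          theta (iterz tau (m%:Z + 1) (iterz sigma (- m%:Z - 1) p))
                (iterz tau m%:Z (iterz sigma (- m%:Z) p))
          * f (iterz tau m%:Z (iterz sigma (- m%:Z - 1) p))
    else if idx p == 0 then 0
    else
      \sum_(1 <= m < `|idx p|%N.+1)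
          theta (iterz tau (- m%:Z + 1) (iterz sigma (m%:Z - 1) p))
                (iterz tau (- m%:Z) (iterz sigma m%:Z p))
          * f (iterz tau (- m%:Z) (iterz sigma (m%:Z - 1) p)).

(* Pointwise operations; a unit is not required, so unital algebras of
   functions are a special case. *)
Definition function_algebra (R : realType) (M : Type)
    (A : {pred (M -> R^o)}) :=
  GRing.submod_closed A /\ GRing.mulr_2closed A.

(* Operators on a subspace X of V are represented by maps V -> V, of which
   only the values on X matter. *)
Definition stable_on (V : Type) (X : {pred V}) (T : V -> V) :=
  {in X, forall f, T f \in X}.

Definition linear_on (R : pzRingType) (V : lmodType R) (X : {pred V})
    (T : V -> V) :=
  forall a : R, {in X &, forall f g, T (a *: f + g) = a *: T f + T g}.

Definition linear_operator_in (R : pzRingType) (V : lmodType R)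
    (X : {pred V}) (T : V -> V) :=
  stable_on X T /\ linear_on X T.

Definition right_inverse_in (R : pzRingType) (V : lmodType R)
    (X : {pred V}) (D S : V -> V) :=
  [/\ linear_operator_in X D, linear_operator_in X S
    & {in X, forall f, D (S f) = f}].

(* Main.v *)
Require Import Defs.
From HB Require Import structures.
From mathcomp Require Import all_boot all_order all_algebra.
From mathcomp Require Import all_classical all_reals.

(** The map [s := tau \o sigma^-1] raises the index by one, so the orbits of
    [s] meet every class of the partition and behave like copies of the
    integers with the index as coordinate.  Writing [q = sigma p], the equation
    [D g = f] says [g (s q) - g q = theta (s q) q * f (sigma^-1 q)]: along an
    orbit, [g] is an antidifference of a known function.  The proposed right
    inverse is the antidifference that vanishes at index 0.

    Both branches of its definition are made of values of one function
    [orbit_term], indexed by an integer: the summands with indices from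
    [0] on when [idx p < 0], those with indices from [- idx p] to [-1] when
    [idx p > 0].  Since [tau] and [sigma] commute, moving the base point from
    [p] to [s p] merely shifts this integer by one ([orbit_term_step]).  The
    sums at [q] and at [s q] therefore overlap in all their summands but the
    one of integer index 0 at [q], which is the required increment
    ([quantum_sum_step]).  Dividing by [theta (s q) q > 0] gives [D (RI f) = f]
    and linearity is inherited from finite sums. *)

Import Order.TTheory GRing.Theory Num.Theory.

Local Open Scope classical_set_scope.
Local Open Scope ring_scope.

Section Iterates.
Set Implicit Arguments.
Unset Strict Implicit.
Variable M : Type.
Implicit Types (f tau sigma : {splitbij [set: M] >-> [set: M]}) (h : M -> M).

Lemma splitbijK f : cancel f f^-1%FUN.
Proof. by move=> x; apply: funK; rewrite inE. Qed.

Lemma splitbijVK f : cancel f^-1%FUN f.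
Proof. by move=> x; apply: invK; rewrite inE. Qed.

Lemma iterzSr f z p : iterz f (z + 1) p = iterz f z (f p).
Proof.
case: z => [n|[|n]].
- by rewrite -PoszD addn1 /= -iterS iterSr.
- by rewrite /= splitbijK.
- have -> : Negz n.+1 + 1 = Negz n by rewrite !NegzE -addn1 PoszD opprD addrNK.
  by rewrite /iterz (iterSr n.+1) splitbijK.
Qed.

Lemma iterzPr f z p : iterz f (z - 1) p = iterz f z (f^-1%FUN p).
Proof. by rewrite -{2}(subrK 1 z) iterzSr splitbijVK. Qed.

Lemma commute_inv f h : (forall p, h (f p) = f (h p)) ->
  forall p, h (f^-1%FUN p) = f^-1%FUN (h p).
Proof.
by move=> hf p; apply: (can_inj (splitbijK f)); rewrite -hf !splitbijVK.
Qed.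

Lemma commute_iterz f h z : (forall p, h (f p) = f (h p)) ->
  forall p, h (iterz f z p) = iterz f z (h p).
Proof.
move=> hf p; have hi := commute_inv hf.
case: z => n /=; last by rewrite hi; congr (_ _); elim: n => //= n <-.
by elim: n => //= n <-.
Qed.

Lemma iterz_step tau sigma z w p :
  (forall p, tau (sigma p) = sigma (tau p)) ->
  iterz tau z (iterz sigma w (tau (sigma^-1%FUN p))) =
  iterz tau (z + 1) (iterz sigma (w - 1) p).
Proof. by move=> ts; rewrite iterzSr iterzPr (commute_iterz _ ts). Qed.

End Iterates.

Section QuantumSum.
Set Implicit Arguments.
Unset Strict Implicit.
Variables (R : realType) (M : Type) (theta : M -> M -> R).
Variables (tau sigma : {splitbij [set: M] >-> [set: M]}).
Variables (Mk : int -> set M) (idx : M -> int).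
Hypothesis comm_ts : forall p, tau (sigma p) = sigma (tau p).
Hypothesis partM : quantum_partition tau sigma Mk.
Hypothesis idxM : index_function Mk idx.

(** With [s = tau \o sigma^-1] this is
    [theta (s^(z+1) p) (s^z p) * f (sigma^-1 (s^z p))], the increment between
    the points [s^z p] and [s^(z+1) p] of the orbit. *)
Definition orbit_term (f : M -> R^o) (p : M) (z : int) : R :=
  theta (iterz tau (z + 1) (iterz sigma (- z - 1) p))
        (iterz tau z (iterz sigma (- z) p))
  * f (iterz tau z (iterz sigma (- z - 1) p)).

Lemma orbit_term0 f p :
  orbit_term f p 0 = theta (tau (sigma^-1%FUN p)) p * f (sigma^-1%FUN p).
Proof. by []. Qed.

Lemma orbit_term_step f p z :
  orbit_term f (tau (sigma^-1%FUN p)) z = orbit_term f p (z + 1).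
Proof. by rewrite /orbit_term !(iterz_step _ _ _ comm_ts) !opprD. Qed.

Lemma idx_step p : idx (tau (sigma^-1%FUN p)) = idx p + 1.
Proof.
case: partM => _ _ /(_ (idx p)) [mapM _ _].
by apply/idxM; apply: mapM; apply/idxM.
Qed.

Lemma quantum_sum_neg f p (n : nat) : idx p = - n%:Z ->
  quantum_sum theta tau sigma idx f p =
  - \sum_(0 <= m < n) orbit_term f p m%:Z.
Proof.
rewrite /quantum_sum => ->; case: n => [|n]; first by rewrite big_geq // !oppr0.
by rewrite abszN lerN2.
Qed.

Lemma quantum_sum_pos f p (n : nat) : idx p = n%:Z ->
  quantum_sum theta tau sigma idx f p =
  \sum_(1 <= m < n.+1) orbit_term f p (- m%:Z).
Proof.
rewrite /quantum_sum => ->; case: n => [|n]; first by rewrite [RHS]big_geq.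
by apply: eq_bigr => m _; rewrite /orbit_term opprK.
Qed.

(** The increment of the antidifference does not depend on the side of
    index 0: for [idx p >= 0] the sum gains a new first summand at the
    next point, for [idx p < 0] the negated sum loses its first one. *)
Lemma quantum_sum_step f p :
  quantum_sum theta tau sigma idx f (tau (sigma^-1%FUN p)) =
  quantum_sum theta tau sigma idx f p + orbit_term f p 0.
Proof.
have := idx_step p; case idxE: (idx p) => [n|n] idxS.
  have idxS' : idx (tau (sigma^-1%FUN p)) = n.+1 by rewrite idxS -PoszD addn1.
  rewrite (quantum_sum_pos _ idxE) (quantum_sum_pos _ idxS').
  rewrite big_nat_recl // orbit_term_step addNr addrC; congr (_ + _).
  apply: eq_big_nat => m _.
  by rewrite orbit_term_step -addn1 PoszD opprD addrNK.
rewrite NegzE in idxE idxS.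
have idxS' : idx (tau (sigma^-1%FUN p)) = - n%:Z.
  by rewrite idxS -addn1 PoszD opprD addrNK.
rewrite (quantum_sum_neg _ idxE) (quantum_sum_neg _ idxS').
rewrite big_nat_recl // opprD addrAC addNr add0r; congr (- _).
by apply: eq_bigr => m _; rewrite orbit_term_step -PoszD addn1.
Qed.

Lemma quantum_derivativeK (theta_gt0 : forall p, 0 < theta (tau p) (sigma p)) :
  cancel (quantum_sum theta tau sigma idx) (quantum_derivative theta tau sigma).
Proof.
move=> f; apply/funext => p; rewrite /quantum_derivative.
have := quantum_sum_step f (sigma p); rewrite orbit_term0 splitbijK => ->.
by rewrite addrAC subrr add0r mulrAC mulfV ?mul1r // gt_eqF.
Qed.

Lemma quantum_sum_linear (a : R) (f g : M -> R^o) :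
  quantum_sum theta tau sigma idx (a *: f + g) =
  a *: quantum_sum theta tau sigma idx f + quantum_sum theta tau sigma idx g.
Proof.
have termD p z : orbit_term (a *: f + g) p z =
                 a * orbit_term f p z + orbit_term g p z.
  by rewrite /orbit_term [in LHS]/= mulrDr mulrCA.
apply/funext => p.
change (quantum_sum theta tau sigma idx (a *: f + g) p =
        a * quantum_sum theta tau sigma idx f p +
        quantum_sum theta tau sigma idx g p).
case idxE: (idx p) => [n|n].
  rewrite !(quantum_sum_pos _ idxE) mulr_sumr -big_split.
  by apply: eq_bigr => m _; rewrite termD.
rewrite NegzE in idxE; rewrite !(quantum_sum_neg _ idxE).
rewrite mulrN -opprD mulr_sumr -big_split; congr (- _).
by apply: eq_bigr => m _; rewrite termD.
Qed.

Lemma quantum_derivative_linear (a : R) (f g : M -> R^o) :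
  quantum_derivative theta tau sigma (a *: f + g) =
  a *: quantum_derivative theta tau sigma f +
  quantum_derivative theta tau sigma g.
Proof.
apply/funext => p.
change ((a * f (tau p) + g (tau p) - (a * f (sigma p) + g (sigma p)))
          / theta (tau p) (sigma p) =
        a * ((f (tau p) - f (sigma p)) / theta (tau p) (sigma p)) +
        (g (tau p) - g (sigma p)) / theta (tau p) (sigma p)).
by rewrite mulrA -mulrDl mulrBr opprD addrACA.
Qed.

End QuantumSum.

Theorem proposition6p10 (R : realType) (M : Type) (theta : M -> M -> R)
    (tau sigma : {splitbij [set: M] >-> [set: M]})
    (Mk : int -> set M) (idx : M -> int) (A : {pred (M -> R^o)}) :
  tension_space theta ->
  (forall p : M, tau (sigma p) = sigma (tau p)) ->
  (forall p : M, 0 < theta (tau p) (sigma p)) ->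
  quantum_partition tau sigma Mk ->
  index_function Mk idx ->
  function_algebra A ->
  {in A, forall f : M -> R^o, f \o sigma \in A} ->
  {in A, forall f : M -> R^o, f \o tau \in A} ->
  stable_on A (quantum_derivative theta tau sigma) ->
  let D := quantum_derivative theta tau sigma in
  let RI := quantum_sum theta tau sigma idx in
  [/\ linear_on A RI,
      {in A, forall f : M -> R^o, D (RI f) = f}
    & stable_on A RI -> right_inverse_in A D RI].
Proof.
move=> _ comm_ts theta_gt0 partM idxM _ _ _ stabD D RI.
have linRI : linear_on A RI by move=> a f g _ _; apply: quantum_sum_linear.
have RIK : {in A, forall f : M -> R^o, D (RI f) = f}.
  by move=> f _; apply: (quantum_derivativeK comm_ts partM idxM theta_gt0).
split=> // stabRI; split=> //; split=> // a f g _ _.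
exact: quantum_derivative_linear.
Qed.
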